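(* Let $(\Omega,\mathcal F,\mu,T)$ be a nonsingular dynamical system on a non-atomic measure space which is totally dissipative. Then it is factor-universal: for every nonsingular dynamical system $(\Omega',\mathcal F',\mu',S)$ there exists a measurable map $\pi:\Omega\to\Omega'$ with $\pi\circ T=S\circ\pi$ $\mu$-almost everywhere and $\mu\circ\pi^{-1}\sim\mu'$.
   Context: All measure spaces are standard $\sigma$-finite measure spaces with nonzero measure. $\mu\sim\nu$ means the two measures have the same null sets. A nonsingular dynamical system $(\Omega,\mathcal F,\mu,T)$ consists of such a space and an invertible bimeasurable map $T:\Omega\to\Omega$ with $\mu\circ T^{-1}\sim\mu$ (that is, a nonsingular $\mathbb Z$-action). A set $W\in\mathcal F$ is wandering if the sets $T^nW$, $n\in\mathbb Z$, are pairwise disjoint. The system is totally dissipative if there is a wandering set $W$ with $\biguplus_{n\in\mathbb Z}T^nW=\Omega$ modulo a $\mu$-null set. The system $(\Omega',\mathcal F',\mu',S)$ need not be non-atomic, ergodic, or dissipative. *)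

(* Defs.v *)
From HB Require Import structures.
From mathcomp Require Import all_boot all_order all_algebra.
From mathcomp Require Import all_classical all_reals all_analysis.

Set Implicit Arguments.
Unset Strict Implicit.
Unset Printing Implicit Defensive.

Import Order.TTheory GRing.Theory Num.Theory.
Import numFieldNormedType.Exports.

Local Open Scope classical_set_scope.
Local Open Scope ring_scope.

Definition polish_space (R : realType) (P : metricType R) : Prop :=
  (exists2 D : set P, countable D & dense D) /\
  (forall F : set_system P, ProperFilter F -> cauchy F -> exists l : P, F --> l).

(* As [phi] is bijective, the last equation says that [phi] is an isomorphism
   between [X] and [P] equipped with its Borel sigma-algebra [<<s open>>]. *)
Definition standard_borel (R : realType) (d : measure_display)
    (X : measurableType d) : Prop :=
  exists (P : metricType R) (phi : X -> P),
    [/\ polish_space P, bijective phi &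
        (measurable : set (set X)) =
          [set phi @^-1` B | B in <<s (open : set (set P)) >>]].

Definition measure_equiv (R : realType) (d : measure_display)
    (X : measurableType d) (mu nu : set X -> \bar R) : Prop :=
  mu `<< nu /\ nu `<< mu.

Definition atom (R : realType) (d : measure_display) (X : measurableType d)
    (mu : set X -> \bar R) (A : set X) : Prop :=
  [/\ measurable A, mu A <> 0%E &
      forall B, measurable B -> B `<=` A -> mu B = 0%E \/ mu (A `\` B) = 0%E].

Definition non_atomic (R : realType) (d : measure_display)
    (X : measurableType d) (mu : set X -> \bar R) : Prop :=
  forall A, ~ atom mu A.

Definition bimeasurable_bijection (d : measure_display) (X : measurableType d)
    (T : X -> X) : Prop :=
  [/\ bijective T, measurable_fun setT T &
      forall A, measurable A -> measurable (T @` A)].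

Definition nonsingular_system (R : realType) (d : measure_display)
    (X : measurableType d) (mu : {sigma_finite_measure set X -> \bar R})
    (T : X -> X) : Prop :=
  [/\ standard_borel R X, mu setT <> 0%E, bimeasurable_bijection T &
      measure_equiv (pushforward mu T) mu].

(* [T^n W] for [n : int]. Since [Negz k] is [- k.+1], the second case is the
   preimage under [T^(k+1)], the image under [T^n] when [T] is bijective. *)
Definition translate (X : Type) (T : X -> X) (n : int) (W : set X) : set X :=
  match n with
  | Posz k => iter k T @` W
  | Negz k => iter k.+1 T @^-1` W
  end.

Definition wandering (d : measure_display) (X : measurableType d) (T : X -> X)
    (W : set X) : Prop :=
  measurable W /\ trivIset [set: int] (fun n => translate T n W).

Definition totally_dissipative (R : realType) (d : measure_display)
    (X : measurableType d) (mu : set X -> \bar R) (T : X -> X) : Prop :=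
  exists2 W : set X, wandering T W &
    mu.-negligible (~` \bigcup_(n in [set: int]) translate T n W).

Definition factor_map (R : realType) (d d' : measure_display)
    (X : measurableType d) (Y : measurableType d')
    (mu : {measure set X -> \bar R}) (T : X -> X)
    (nu : {measure set Y -> \bar R}) (S : Y -> Y) (p : X -> Y) : Prop :=
  [/\ measurable_fun setT p, {ae mu, forall x, p (T x) = S (p x)} &
      measure_equiv (pushforward mu p) nu].

Definition factor_universal (R : realType) (d : measure_display)
    (X : measurableType d) (mu : {measure set X -> \bar R}) (T : X -> X)
    : Prop :=
  forall (d' : measure_display) (Y : measurableType d')
    (nu : {sigma_finite_measure set Y -> \bar R}) (S : Y -> Y),
    nonsingular_system nu S ->
    exists p : X -> Y, factor_map mu T nu S p.

(* Main.v *)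
(* On a wandering set [W] whose translates exhaust the space, an equivariant map
   [p] is freely determined by its restriction [f] to [W]: put
   [p = S^n f T^-n] on [T^n W]. By nonsingularity of [T] and [S], [p] pushes [mu]
   to a measure equivalent to [nu] as soon as [f] does so for [mu] restricted to
   [W]. Both measures may be replaced by equivalent probabilities, so it is
   enough to map a non-atomic probability [mu] onto an arbitrary probability [nu]
   on a Polish space. Let [B_k] enumerate the balls of dyadic radii centred at a
   dense sequence. As non-atomic measures take all intermediate values, there are
   sets [A_k] in the source such that every finite Boolean combination of the
   [A_k] has the same measure as the corresponding combination of the [B_k]. For
   almost every [x], the balls [B_k] with [x] in [A_k] shrink to a single point
   [f x], and [f] carries [mu] to [nu]. *)
Require Import Defs.
From HB Require Import structures.
From mathcomp Require Import all_boot all_order all_algebra.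
From mathcomp Require Import all_classical all_reals all_analysis.
From mathcomp Require Import lra.

Import Order.TTheory GRing.Theory Num.Theory.
Import numFieldNormedType.Exports.

Local Open Scope classical_set_scope.
Local Open Scope ring_scope.

(** * Intermediate values of a finite non-atomic measure *)

Section nonatomic_intermediate_values.
Context (R : realType) (d : measure_display) (X : measurableType d).
Variable mu : {finite_measure set X -> \bar R}.
Hypothesis mu_na : non_atomic mu.

Let m (A : set X) : R := fine (mu A).

Let muE (A : set X) : measurable A -> mu A = (m A)%:E.
Proof. by move=> mA; rewrite /m fineK// fin_num_measure. Qed.

Let m_ge0 (A : set X) : 0 <= m A.
Proof. exact: fine_ge0. Qed.

Let mD (A B : set X) : measurable A -> measurable B -> B `<=` A ->
  m (A `\` B) = m A - m B.
Proof.
move=> mA mB BA; have mAB := measurableD mA mB.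
apply: EFin_inj; rewrite -muE// measureD//; last first.
  by rewrite -ge0_fin_numE// fin_num_measure.
by rewrite (setIidr BA) EFinB -!muE.
Qed.

Let mU (A B : set X) : measurable A -> measurable B -> A `&` B = set0 ->
  m (A `|` B) = m A + m B.
Proof.
move=> mA mB AB; apply: EFin_inj; rewrite -muE; last exact: measurableU.
by rewrite measureU// EFinD -!muE.
Qed.

Let m_mono (A B : set X) : measurable A -> measurable B -> A `<=` B ->
  m A <= m B.
Proof. by move=> mA mB AB; rewrite -lee_fin -!muE// le_measure ?inE. Qed.

(** Since [D] is not an atom, some subset [B] and its complement in [D] both have positive mass; the
    lighter of the two serves as [E]. *)
Lemma subset_half (D : set X) : measurable D -> 0 < m D ->
  exists E, [/\ measurable E, E `<=` D, 0 < m E & 2 * m E <= m D].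
Proof.
move=> mDD D0; apply: contrapT => noE; apply: (mu_na D); split => //.
  by rewrite muE// => -[D00]; move: D0; rewrite D00 ltxx.
move=> B mB BD; have mDB := measurableD mDD mB.
rewrite !muE//; have := m_ge0 B; have := m_ge0 (D `\` B).
have := mD _ _ mDD mB BD.
move=> mDBE; rewrite !le_eqVlt => /orP[/eqP <-|DB0]; first by right.
move=> /orP[/eqP <-|B0]; first by left.
exfalso; apply: noE; have [le2|lt2] := leP (2 * m B) (m D).
  by exists B.
by exists (D `\` B); split => //; rewrite mDBE in DB0 *; lra.
Qed.

Lemma subset_small (D : set X) (e : R) : measurable D -> 0 < m D -> 0 < e ->
  exists E, [/\ measurable E, E `<=` D, 0 < m E & m E < e].
Proof.
move=> mDD D0 e0.
have small n : exists E, [/\ measurable E, E `<=` D, 0 < m E &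
    2 ^+ n * m E <= m D].
  elim: n => [|n [E [mE ED E0 En]]]; first last.
    have [F [mF FE F0 Fn]] := subset_half _ mE E0.
    exists F; split => //; first exact: subset_trans ED.
    by rewrite exprSr -mulrA (le_trans _ En)// ler_wpM2l// exprn_ge0.
  by exists D; split; rewrite ?expr0 ?mul1r.
(* This [n] gives [m D / e < n.+1 <= 2 ^+ n.+1], so [n.+1] halvings of [D] bring the mass below
   [e]. *)
pose n := Num.truncn (m D / e).
have [E [mE ED E0 En]] := small n.+1; exists E; split => //.
have Dn : m D < 2 ^+ n.+1 * e.
  rewrite -ltr_pdivrMr// (lt_le_trans (truncnS_gt _))//.
  by rewrite -natrX ler_nat ltnW// ltn_expl.
by have := le_lt_trans En Dn; rewrite ltr_pM2l// exprn_gt0.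
Qed.

(** The supremum of the possible gains need not be attained, but when positive it is approached
    within a factor 2; when it is 0, [B = A] works. *)
Lemma greedy_extension (D A : set X) (r : R) :
  measurable D -> measurable A -> A `<=` D -> m A <= r ->
  exists B, [/\ measurable B, A `<=` B, B `<=` D, m B <= r &
    forall F, measurable F -> A `<=` F -> F `<=` D -> m F <= r ->
      m F - m A <= 2 * (m B - m A)].
Proof.
move=> mDD mA AD Ar.
pose S := [set x | exists F, [/\ measurable F, A `<=` F, F `<=` D, m F <= r &
  x = m F - m A]].
have S0 : S 0 by exists A; split => //; rewrite subrr.
have ubS : ubound S r.
  by move=> _ [F [mF AF FD Fr ->]]; rewrite lerBlDr (le_trans Fr)// lerDl.
have supS : has_sup S by split; [exists 0 | exists r].
have leS F : measurable F -> A `<=` F -> F `<=` D -> m F <= r ->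
    m F - m A <= sup S.
  by move=> mF AF FD Fr; apply: sup_ubound; [case: supS|exists F; split].
have := sup_ubound supS.2 S0.
rewrite /= le_eqVlt => /orP[/eqP S00|Spos].
  exists A; split => // F mF AF FD Fr; have := leS _ mF AF FD Fr.
  by rewrite -S00 subrr mulr0.
have S2 : 0 < sup S / 2 by rewrite divr_gt0.
have [_ [B [mB AB BD Br ->]] SB] := sup_adherent S2 supS.
exists B; split => // F mF AF FD Fr; apply: (le_trans (leS _ mF AF FD Fr)); lra.
Qed.

(* Greedy exhaustion: an increasing sequence of subsets of measure at most [r],
   each step gaining at least half of what is possible; a positive deficit in
   the limit would leave room for one fixed small set at every step. *)
Lemma intermediate_value_subset (D : set X) (r : \bar R) : measurable D ->
  (0 <= r)%E -> (r <= mu D)%E ->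
  exists E, [/\ measurable E, E `<=` D & mu E = r].
Proof.
move=> mDD r0 rD.
case: r r0 rD => [r||]//; last by rewrite muE.
rewrite lee_fin => r0 rD.
pose good A := [/\ measurable A, A `<=` D & m A <= r].
pose next (A B : set X) := [/\ good B, A `<=` B & forall F, measurable F ->
  A `<=` F -> F `<=` D -> m F <= r -> m F - m A <= 2 * (m B - m A)].
have [g gP] : {g : set X -> set X & forall A, good A -> next A (g A)}.
  apply: (@choice _ _ (fun A B => good A -> next A B)) => A.
  have [[mA AD Ar]|] := pselect (good A); last by exists A.
  by have [B [*]] := greedy_extension _ _ _ mDD mA AD Ar; exists B; split.
pose E n := iter n g set0.
have Egood n : good (E n).
  elim: n => [|n IH]; last by have [] := gP _ IH.
  by split => //=; rewrite /m measure0.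
have Enext n : next (E n) (E n.+1) by exact: gP.
have mE n : measurable (E n) by case: (Egood n).
have mUE : measurable (\bigcup_n E n) by exact: bigcupT_measurable.
have UED : \bigcup_n E n `<=` D by apply: bigcup_sub => n _; case: (Egood n).
have ndE : {homo E : i j / (i <= j)%N >-> (i <= j)%O}.
  by apply/nondecreasing_seqP => n; apply/subsetPset; case: (Enext n).
have Ecvg := nondecreasing_cvg_mu (mu := mu) mE mUE ndE.
have Er : (mu (\bigcup_n E n) <= r%:E)%E.
  have <- := cvg_lim _ Ecvg => //; apply: lime_le.
    by apply/cvg_ex; eexists; exact: Ecvg.
  by apply: nearW => n /=; rewrite muE// lee_fin; case: (Egood n).
exists (\bigcup_n E n); split => //.
apply/eqP; rewrite eq_le Er /= leNgt; apply/negP.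
rewrite muE// lte_fin => gap.
have mG : measurable (D `\` \bigcup_n E n) by exact: measurableD.
have [||F [mF FG F0 Fe]] := subset_small _ (r - m (\bigcup_n E n)) mG.
- rewrite mD// subr_gt0; apply: (lt_le_trans gap).
  by move: rD; rewrite muE.
- by rewrite subr_gt0.
have step n : n%:R * m F <= 2 * m (E n).
  elim: n => [|n IH]; first by rewrite mul0r mulr_ge0.
  have [_ _ /(_ (E n `|` F))] := Enext n.
  have -> : m (E n `|` F) = m (E n) + m F.
    by apply: mU => //; rewrite -subset0 => x [Ex /FG[_]]; apply; exists n.
  have [_ ED _] := Egood n.
  have EU : m (E n) <= m (\bigcup_n E n).
    by apply: m_mono => //; exact: bigcup_sup.
  move=> /(_ (measurableU _ _ (mE n) mF) (@subsetUl _ _ _)).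
  have EFD : E n `|` F `<=` D by rewrite subUset; split => // x /FG[].
  move=> /(_ EFD) H; rewrite -natr1 mulrDl mul1r.
  have : m (E n) + m F <= r by lra.
  move=> /H; lra.
(* With this [n], the lower bound [step n.+1] exceeds [2 * r], although every [E n] has mass at most
   [r]. *)
pose n := Num.truncn (2 * r / m F).
have : 2 * r < n.+1%:R * m F by rewrite -ltr_pdivrMr// truncnS_gt.
have := step n.+1; have [_ _] := Egood n.+1; lra.
Qed.

End nonatomic_intermediate_values.

(** * Countable unions and Boolean cells of a sequence of sets *)

Lemma negligible_bigcup_countable (R : realType) (d : measure_display)
    (X : measurableType d) (mu : {measure set X -> \bar R}) (I : countType)
    (D : set I) (F : I -> set X) :
  (forall i, D i -> mu.-negligible (F i)) ->
  mu.-negligible (\bigcup_(i in D) F i).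
Proof.
move=> nF.
pose G k := if unpickle k is Some i then
  (if `[< D i >] then F i else set0) else set0.
apply: (negligibleS (B := \bigcup_(i in D) F i) (A := \bigcup_k G k)).
  by move=> x [i Di Fix]; exists (pickle i) => //; rewrite /G pickleK asboolT.
apply: negligible_bigcup => k; rewrite /G; case: unpickle => [i|].
  by case: asboolP => [/nF//|_]; exact: negligible_set0.
exact: negligible_set0.
Qed.

(** Words are read from the right: the last letter decides [A 0], the head decides [A (size s')].
    Refining a cell by the next set is thus a [cons]. *)
Fixpoint cell (X : Type) (A : nat -> set X) (s : seq bool) : set X :=
  if s is b :: s' then
    cell X A s' `&` (if b then A (size s') else ~` A (size s'))
  else setT.
Arguments cell {X}.

Lemma measurable_cell (d : measure_display) (X : measurableType d)
    (A : nat -> set X) (s : seq bool) :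
  (forall k, measurable (A k)) -> measurable (cell A s).
Proof.
move=> mA; elim: s => [|[] s IH] /=; first exact: measurableT.
- exact: measurableI.
- by apply: measurableI => //; exact: measurableC.
Qed.

Lemma cell_code (X : Type) (A : nat -> set X) (x : X) (n : nat) :
  exists2 s, size s = n & cell A s x.
Proof.
elim: n => [|n [s sn As]]; first by exists [::].
have [Anx|Anx] := pselect (A n x).
- by exists (true :: s); rewrite /= sn.
- by exists (false :: s); rewrite /= sn.
Qed.

Lemma cell_agree (X Y : Type) (A : nat -> set X) (B : nat -> set Y) s x y :
  cell A s x -> cell B s y -> forall k, (k < size s)%N -> A k x <-> B k y.
Proof.
elim: s => [//|b s IH] /= [Asx Abx] [Bsy Bby] k; rewrite ltnS leq_eqVlt.
by move=> /orP[/eqP ->|/IH]; [case: b Abx Bby|apply].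
Qed.

Section cell_measure.
Context (R : realType).

(** When [g] gives the measures of cells, this is the mass of the part of the cell [s] covered by
    the [A k] with [k] in [K] and [size s <= k < size s + n]. It depends on the sets only through
    [g]. *)
Fixpoint union_mass (K : set nat) (g : seq bool -> \bar R) (n : nat)
    (s : seq bool) : \bar R :=
  if n is n'.+1 then
    ((if size s \in K then g (true :: s) else union_mass K g n' (true :: s))
     + union_mass K g n' (false :: s))%E
  else 0%E.

Context (d : measure_display) (X : measurableType d).
Context (mu : {measure set X -> \bar R}) (A : nat -> set X).
Hypothesis mA : forall k, measurable (A k).

Let U (K : set nat) (a n : nat) : set X :=
  \bigcup_(k in [set k | K k /\ (a <= k < a + n)%N]) A k.

Let mU (K : set nat) (a n : nat) : measurable (U K a n).
Proof. by apply: bigcup_measurable => k _; exact: mA. Qed.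

(** Split the cell along [A (size s)]: if [size s] is in [K], the inner half is covered entirely; in
    all other cases the covering is left to later indices. *)
Lemma measure_cell_union (K : set nat) (n : nat) (s : seq bool) :
  mu (cell A s `&` U K (size s) n) = union_mass K (mu \o cell A) n s.
Proof.
elim: n s => [|n IH] s /=.
  rewrite (_ : _ `&` _ = set0) ?measure0// -subset0 => x [_ [k [_]]].
  by rewrite addn0 => /andP[/leq_ltn_trans /[apply]]; rewrite ltnn.
have mc b := measurable_cell _ _ _ (b :: s) mA.
have mUn : measurable (U K (size s).+1 n) by exact: mU.
rewrite -(IH (false :: s)).
have -> : cell A s `&` U K (size s) n.+1 =
    (if size s \in K then cell A (true :: s)
     else cell A (true :: s) `&` U K (size s).+1 n) `|`
    (cell A (false :: s) `&` U K (size s).+1 n).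
  apply/seteqP; split=> x.
  - move=> [cx [k [Kk /andP[]]]].
    rewrite leq_eqVlt => /orP[/eqP sk|sk] kn Akx; first last.
      have Ux : U K (size s).+1 n x.
        by exists k => //; split => //; rewrite sk addSnnS.
      have [Asx|Asx] := pselect (A (size s) x); last by right.
      by left; case: ifP.
    by subst k; left; rewrite mem_set.
  - case=> [|[[cx _]] [k [Kk /andP[sk kn]] Akx]]; last first.
      split => //; exists k => //; split => //.
      by rewrite ltnW//= addnS -addSn.
    case: ifPn => [/set_mem Ks [cx Ax]|_ [[cx _] [k [Kk /andP[sk kn]] Akx]]].
      split => //; exists (size s) => //; split => //.
      by rewrite leqnn addnS ltnS leq_addr.
    split => //; exists k => //; split => //.
    by rewrite ltnW//= addnS -addSn.
rewrite measureU; first last.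
- rewrite -subset0 => x; case: ifPn => _ /=; first by move=> [[_ ?] [[]]].
  by move=> [[[_ ?] _] [[]]].
- by apply: measurableI => //; exact: mc.
- case: ifPn => _; first exact: mc.
  by apply: measurableI => //; exact: mc.
congr (_ + _)%E; case: ifPn => // _; exact: (IH (true :: s)).
Qed.

Lemma cvg_union_mass (K : set nat) :
  union_mass K (mu \o cell A) n [::] @[n --> \oo] -->
    mu (\bigcup_(k in K) A k).
Proof.
have -> : \bigcup_(k in K) A k = \bigcup_n U K 0 n.
  apply/seteqP; split=> [x [k Kk Akx]|x [n _ [k [Kk _] Akx]]]; last by exists k.
  by exists k.+1 => //; exists k => //; split => //=; rewrite add0n.
under eq_fun do rewrite -measure_cell_union /= setTI.
apply: nondecreasing_cvg_mu; [exact: mU|exact: bigcupT_measurable|].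
move=> n p np; apply/subsetPset => x [k [Kk /andP[_ kn]] Akx].
by exists k => //; split => //=; exact: leq_trans np.
Qed.

End cell_measure.

(** Finite unions have masses given by the same recursion on cell measures on both sides; continuity
    from below passes to infinite unions. *)
Lemma measure_bigcup_cells (R : realType) (d d' : measure_display)
    (X : measurableType d) (Y : measurableType d')
    (mu : {measure set X -> \bar R}) (nu : {measure set Y -> \bar R})
    (A : nat -> set X) (B : nat -> set Y) (K : set nat) :
  (forall k, measurable (A k)) -> (forall k, measurable (B k)) ->
  (forall s, mu (cell A s) = nu (cell B s)) ->
  mu (\bigcup_(k in K) A k) = nu (\bigcup_(k in K) B k).
Proof.
move=> mA mB AB.
have := cvg_union_mass R _ _ mu A mA K.
rewrite (_ : mu \o cell A = nu \o cell B); last exact/funext.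
by move=> /cvg_unique; apply => //; exact: cvg_union_mass.
Qed.

(** * Sets with prescribed cell measures in a non-atomic space *)

Section transfer.
Context (R : realType) (d d' : measure_display).
Context (X : measurableType d) (Y : measurableType d').
Context (mu : probability X R) (nu : probability Y R).
Hypothesis mu_na : non_atomic mu.

(** The cells come first, as a binary tree [C]: each node is cut by intermediate values into
    children with the masses of the corresponding cells of [B]. Then [A k] collects the children
    labelled [true] born at level [k]. *)
Lemma exists_cells (B : nat -> set Y) : (forall k, measurable (B k)) ->
  exists A : nat -> set X, (forall k, measurable (A k)) /\
    forall s, mu (cell A s) = nu (cell B s).
Proof.
move=> mB.
have mcB s : measurable (cell B s) by exact: measurable_cell.
have [h hP] : {h : set X * \bar R -> set X & forall p, measurable p.1 ->
    (0 <= p.2 <= mu p.1)%E ->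
    [/\ measurable (h p), h p `<=` p.1 & mu (h p) = p.2]}.
  apply: (@choice _ _ (fun p E => measurable p.1 -> (0 <= p.2 <= mu p.1)%E ->
    [/\ measurable E, E `<=` p.1 & mu E = p.2])) => -[D r] /=.
  have [mD|] := pselect (measurable D); last by exists set0.
  have [/andP[r0 rD]|] := boolP (0 <= r <= mu D)%E; last by exists set0.
  have [E ?] := intermediate_value_subset _ _ _ mu mu_na D r mD r0 rD.
  by exists E.
pose C := fix C s := if s is b :: s' then
  (if b then h (C s', nu (cell B (true :: s')))
   else C s' `\` h (C s', nu (cell B (true :: s')))) else setT.
have Bs s : (nu (cell B (true :: s)) <= nu (cell B s))%E.
  by apply: le_measure; rewrite ?inE; [exact: (mcB (true :: s))|exact: mcB|
    exact: subIsetl].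
have CP s : measurable (C s) /\ mu (C s) = nu (cell B s).
  elim: s => [|b s [mC muC]]; first by rewrite /= !probability_setT.
  have [|/= mh hC muh] := hP (C s, nu (cell B (true :: s))) mC.
    by rewrite /= measure_ge0 muC Bs.
  case: b => /=; first by [].
  split; first exact: measurableD.
  rewrite measureD//; last by rewrite -ge0_fin_numE// fin_num_measure.
  rewrite setIidr// [X in (X - _)%E]muC [X in (_ - X)%E]muh -setDE measureD//.
  by rewrite -ge0_fin_numE// fin_num_measure.
have hC s : h (C s, nu (cell B (true :: s))) `<=` C s.
  have [mC muC] := CP s; have [|//] := hP (C s, nu (cell B (true :: s))) mC.
  by rewrite /= measure_ge0 muC Bs.
(* Nodes of the same level are disjoint, so [A (size s)] meets [C s] only in the [true] child of
   [s]; hence [cell A s = C s]. *)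
have Ctriv s t x : size s = size t -> C s x -> C t x -> s = t.
  elim: s t => [|b s IH] [|c t]//= [st] sx tx.
  have sub u b' : C (b' :: u) `<=` C u.
    by case: b' => /=; [exact: hC|exact: subDsetl].
  have E : s = t by apply: IH st (sub _ b _ sx) (sub _ c _ tx).
  by subst t; move: b c sx tx => [] [] //= => [hx [_ /(_ hx)]|[_ nhx] /nhx].
pose A k := \bigcup_(s in [set s | size s = k]) C (true :: s).
exists A; split=> [k|s].
  rewrite /A bigcup_mkcond; apply: countable_bigcupT_measurable => // s.
  by case: ifPn => // _; have [] := CP (true :: s).
suff -> : cell A s = C s by have [] := CP s.
elim: s => [//|b s IH] /=; rewrite IH.
have AC x : C s x -> A (size s) x <-> h (C s, nu (cell B s `&` B (size s))) x.
  move=> Csx; split=> [[t /= ts Ctx]|hx]; last by exists s.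
  have <- // : t = s.
  apply: (Ctriv t s x) => //.
  exact: hC _ _ Ctx.
case: b; apply/seteqP; split=> x.
- by move=> [Cx /AC]; apply.
- by move=> hx; have Cx := hC s _ hx; split => //; apply/AC.
- by move=> [Cx Ax]; split => // /(AC _ Cx).
- by move=> [Cx hx]; split => // /(AC _ Cx).
Qed.

End transfer.

(** * Dyadic balls around a dense sequence in a complete metric space *)

Section dyadic_balls.
Context (R : realType) (M : metricType R) (q : nat -> M).

Definition dyrad (j : nat) : R := (2 ^+ j)^-1.

Let dyrad_gt0 j : 0 < dyrad j. Proof. by rewrite invr_gt0 exprn_gt0. Qed.

Let dyrad_small (e : R) : 0 < e -> exists j, dyrad j < e.
Proof.
move=> e0; exists (Num.truncn e^-1).+1.
rewrite /dyrad invf_plt ?posrE ?exprn_gt0//.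
rewrite (lt_le_trans (truncnS_gt _))//.
by rewrite -natrX ler_nat ltnW// ltn_expl.
Qed.

Let dyrad_nincr i j : (i <= j)%N -> dyrad j <= dyrad i.
Proof.
by move=> ij; rewrite /dyrad lef_pV2 ?posrE ?exprn_gt0// ler_eXn2l// ltr1n.
Qed.

Definition ball_index (i j : nat) : nat := pickle (i, j).

Definition dyadic_ball (k : nat) : set M :=
  if unpickle k is Some (i, j) then [set y | mdist (q i) y < dyrad j] else set0.

Lemma dyadic_ballE i j y :
  dyadic_ball (ball_index i j) y = (mdist (q i) y < dyrad j) :> Prop.
Proof. by rewrite /dyadic_ball /ball_index pickleK. Qed.

Lemma open_mdist (x : M) (r : R) : open [set y | mdist x y < r].
Proof.
rewrite openE => y /= xy; apply/nbhs_ballP; exists (r - mdist x y) => /=.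
  by rewrite subr_gt0.
move=> z; rewrite ballEmdist /= => yz.
by rewrite (le_lt_trans (metric_triangle _ y _))// -ltrBrDl.
Qed.

Lemma open_dyadic_ball k : open (dyadic_ball k).
Proof.
rewrite /dyadic_ball; case: unpickle => [[i j]|]; last exact: open0.
exact: open_mdist.
Qed.

(** The doubled radius leaves room for a limit point known only to satisfy the non-strict bound
    [mdist (q i) z <= dyrad j]. *)
Definition dyadic_inside (U : set M) : set nat :=
  [set k | exists i j, k = ball_index i j /\
    [set y | mdist (q i) y < dyrad j *+ 2] `<=` U].

Hypothesis q_dense : forall y (e : R), 0 < e -> exists i, mdist (q i) y < e.

Lemma dyadic_cover y j : exists i, dyadic_ball (ball_index i j) y.
Proof.
by have [i qi] := q_dense y _ (dyrad_gt0 j); exists i; rewrite dyadic_ballE.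
Qed.

Let open_mdist_sub (U : set M) y : open U -> U y ->
  exists2 e : R, 0 < e & [set z | mdist y z < e] `<=` U.
Proof.
rewrite openE => oU /oU /nbhs_ballP[e /= e0 eU]; exists e => //.
by move: eU; rewrite ballEmdist.
Qed.

Lemma bigcup_dyadic_inside (U : set M) : open U ->
  \bigcup_(k in dyadic_inside U) dyadic_ball k = U.
Proof.
move=> oU; apply/seteqP; split=> [y [k [i [j [-> sub]]]]|y Uy].
  rewrite dyadic_ballE => qy; apply: sub => /=.
  by rewrite (lt_trans qy)// mulr2n ltrDl.
have [e e0 eU] := open_mdist_sub _ _ oU Uy.
(* A point of the doubled ball is within [2 * dyrad j] of the centre, and the centre within
   [dyrad j] of [y]: hence the third. *)
have [j je] : exists j, dyrad j < e / 3
    by apply: dyrad_small; rewrite divr_gt0.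
have [i] := dyadic_cover y j; rewrite dyadic_ballE => qy.
exists (ball_index i j); last by rewrite dyadic_ballE.
exists i, j; split => // z /= qz; apply: eU => /=.
rewrite (le_lt_trans (metric_triangle _ (q i) _))// metric_sym.
by move: qz; rewrite mulr2n; lra.
Qed.

Hypothesis M_complete :
  forall F : set_system M, ProperFilter F -> cauchy F -> exists l : M, F --> l.

(* [a] is the set of (indices of) balls containing an unknown point: if every
   finite piece of this information is satisfied by some point and balls of all
   sizes occur, the centres converge. *)
Lemma dyadic_limit (a : set nat) :
  (forall n, exists y, forall k, (k < n)%N -> a k <-> dyadic_ball k y) ->
  (forall j, exists i, a (ball_index i j)) ->
  exists z, forall i j, a (ball_index i j) -> mdist (q i) z <= dyrad j.
Proof.
move=> fin_a cov_a.
have close i j i' j' : a (ball_index i j) -> a (ball_index i' j') ->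
    mdist (q i) (q i') < dyrad j + dyrad j'.
  move=> aij aij'.
  (* A point consistent with the information up to the larger index lies in both balls, which bounds
     the distance of their centres. *)
  have [y yP] := fin_a (maxn (ball_index i j) (ball_index i' j')).+1.
  have := (yP (ball_index i j) _).1 aij.
  have := (yP (ball_index i' j') _).1 aij'.
  rewrite !ltnS leq_maxl leq_maxr !dyadic_ballE => /(_ isT) yij' /(_ isT) yij.
  rewrite (le_lt_trans (metric_triangle _ y _))// ltrD//.
  by rewrite metric_sym.
have [c cP] := choice cov_a.
pose u j := q (c j).
have [l ul] : exists l : M, u @ \oo --> l.
  have uF : ProperFilter (u @ \oo) by exact: fmap_proper_filter.
  apply: (M_complete _ uF); apply/cauchyP => e e0.
  have [j je] : exists j, dyrad j < e / 2
    by apply: dyrad_small; rewrite divr_gt0.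
  exists (u j); exists j => // p /= jp; rewrite ballEmdist /=.
  rewrite (lt_trans (close _ _ _ _ (cP j) (cP p)))//.
  have := dyrad_nincr _ _ jp; lra.
exists l => i j aij; apply/ler_addgt0Pr => e e0.
have e2 : 0 < e / 2 by rewrite divr_gt0.
have [n _ nP] := (cvg_ballP _ _).1 ul _ e2.
have [p pe] := dyrad_small _ e2.
have /= := nP (maxn n p) (leq_maxl _ _); rewrite ballEmdist /= => lu.
have := close _ _ _ _ aij (cP (maxn n p)).
have := dyrad_nincr _ _ (leq_maxr n p).
have := metric_triangle (q i) (u (maxn n p)) l.
rewrite -/(u _) (metric_sym (u _) l); lra.
Qed.

(** Membership of the limit in an open set becomes a countable union of conditions on [a]; this
    later makes the limit map measurable. *)
Lemma dyadic_limit_open (a : set nat) (z : M) (U : set M) :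
  (forall i j, a (ball_index i j) -> mdist (q i) z <= dyrad j) ->
  (forall j, exists i, a (ball_index i j)) -> open U ->
  U z <-> exists2 k, dyadic_inside U k & a k.
Proof.
move=> zP cov_a oU; split=> [Uz|[_ [i [j [-> sub]]] /zP qz]]; last first.
  by apply: sub => /=; rewrite (le_lt_trans qz)// mulr2n ltrDl.
have [e e0 eU] := open_mdist_sub _ _ oU Uz.
have [j je] : exists j, dyrad j < e / 3
    by apply: dyrad_small; rewrite divr_gt0.
have [i aij] := cov_a j; exists (ball_index i j) => //.
exists i, j; split => // y /= qy; apply: eU => /=.
rewrite (le_lt_trans (metric_triangle _ (q i) _))// metric_sym.
by have := zP _ _ aij; move: qy; rewrite mulr2n; lra.
Qed.

End dyadic_balls.
Arguments dyadic_ball {R M}.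
Arguments dyadic_inside {R M}.

(** * A measure-preserving map to a standard Borel probability space *)

Lemma countable_dense_seq (R : realType) (M : metricType R) (D : set M)
    (y0 : M) :
  countable D -> dense D ->
  exists q : nat -> M, forall y (e : R), 0 < e -> exists i, mdist (q i) y < e.
Proof.
move=> cD dD.
have near_D y (e : R) : 0 < e -> exists2 x, D x & mdist x y < e.
  move=> e0; have [|x [/= yx Dx]] := dD _ _ (open_mdist _ _ y e).
    by exists y; rewrite /= mdistxx.
  by exists x => //; rewrite metric_sym.
case: (pfcard_geP cD) => [D0|[q]].
  by have [x] := near_D y0 1 ltr01; rewrite D0.
exists q => y e /(near_D y)[x Dx xy].
by have [i _ qi] := @surj _ _ _ _ q x Dx; exists i; rewrite qi.
Qed.

Lemma standard_borel_map (R : realType) (d d' : measure_display)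
    (X : measurableType d) (Y : measurableType d')
    (mu : probability X R) (nu : probability Y R) :
  non_atomic mu -> standard_borel R Y ->
  exists2 f : X -> Y, measurable_fun setT f &
    forall C, measurable C -> mu (f @^-1` C) = nu C.
Proof.
move=> mu_na [P [phi [[[D cD dD] P_complete] [psi phiK psiK] mE]]].
pose G := [set phi @^-1` U | U in (open : set (set P))].
have mG : G `<=` measurable.
  move=> _ [U oU <-]; rewrite mE; exists U => //.
  exact: sub_sigma_algebra.
have genG : (measurable : set (set Y)) = <<s G >>.
  apply/seteqP; split; last first.
    by apply: smallest_sub => //; exact: sigma_algebra_measurable.
  rewrite mE => _ [B sB <-].
  (* The sets whose preimage under [phi] lies in [<<s G >>] form a sigma-algebra, so it suffices to
     treat open sets. *)
  suff : image_set_system setT phi <<s G >> B.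
    by rewrite /image_set_system /= setTI.
  move: B sB; apply: smallest_sub.
    by apply: sigma_algebra_image; exact: smallest_sigma_algebra.
  move=> U oU; rewrite /image_set_system /= setTI.
  by apply: sub_sigma_algebra; exists U.
have [q q_dense] := countable_dense_seq R P D (phi point) cD dD.
pose B k := phi @^-1` dyadic_ball q k.
have mB k : measurable (B k).
  by apply: mG; exists (dyadic_ball q k) => //; exact: open_dyadic_ball.
have [A [mA AB]] := exists_cells _ _ _ _ _ mu nu mu_na B mB.
have unionAB K := measure_bigcup_cells _ _ _ _ _ mu nu A B K mA mB AB.
pose K j := [set ball_index i j | i in [set: nat]].
have mUA (L : set nat) : measurable (\bigcup_(k in L) A k).
  by apply: bigcup_measurable => k _; exact: mA.
(* Outside the null set [N], every cell containing [x] corresponds to a non-empty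
   cell of [Y], and [x] lies in sets [A k] attached to balls of every radius. *)
pose N := \bigcup_(s in [set s | cell B s = set0]) cell A s `|`
  \bigcup_j ~` \bigcup_(k in K j) A k.
have mN : measurable N.
  apply: measurableU; last first.
    by apply: bigcupT_measurable => k; apply: measurableC; exact: mUA.
  rewrite bigcup_mkcond; apply: countable_bigcupT_measurable => // s.
  by case: ifP => // _; exact: measurable_cell.
have AB0 s : cell B s = set0 -> mu (cell A s) = 0%E.
  by move=> Bs0; rewrite AB Bs0 measure0.
have missed0 j : mu (~` \bigcup_(k in K j) A k) = 0%E.
  rewrite probability_setC ?mUA// unionAB.
  have -> : \bigcup_(k in K j) B k = setT.
    rewrite -subTset => y _.
    have [i yi] := dyadic_cover R P q q_dense (phi y) j.
    by exists (ball_index i j) => //; exists i.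
  by rewrite [X in (_ - X)%E](probability_setT nu) subee.
have N0 : mu N = 0%E.
  apply/negligibleP => //; apply: negligibleU.
    apply: negligible_bigcup_countable => s Bs0; apply/negligibleP.
      exact: measurable_cell.
    exact: AB0.
  apply: negligible_bigcup => j.
  by apply/negligibleP; [apply: measurableC; exact: mUA|exact: missed0].
have coverN x : ~ N x -> forall j, exists i, A (ball_index i j) x.
  move=> Nx j; apply: contrapT => nA; apply: Nx; right.
  exists j => // -[_ [i _ <-] Ax].
  by apply: nA; exists i.
have [z zP] : {z : X -> P & forall x, (N x -> z x = phi point) /\
    (~ N x -> forall i j, A (ball_index i j) x ->
      mdist (q i) (z x) <= dyrad R j)}.
  apply: (@choice _ _ (fun x z => (N x -> z = phi point) /\
    (~ N x -> forall i j, A (ball_index i j) x ->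
      mdist (q i) z <= dyrad R j))) => x.
  have [Nx|Nx] := pselect (N x); first by exists (phi point).
  have [||z zP] := dyadic_limit R P q P_complete [set k | A k x];
    last by exists z.
    move=> n; have [s sn As] := cell_code _ A x n.
    have [y By] : cell B s !=set0.
      by apply/set0P/eqP => Bs0; apply: Nx; left; exists s.
    exists (phi y) => k kn; rewrite -sn in kn.
    exact: (cell_agree _ _ _ _ _ _ _ As By k kn).
  exact: coverN.
pose f x := psi (z x).
have preU U : open U -> measurable (f @^-1` (phi @^-1` U)) /\
    mu (f @^-1` (phi @^-1` U)) = nu (phi @^-1` U).
  move=> oU; pose L := dyadic_inside q U.
  have zU x : ~ N x -> U (z x) <-> exists2 k, L k & A k x.
    move=> Nx; have [_ zC] := zP x.
    exact: dyadic_limit_open (zC Nx) (coverN _ Nx) oU.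
  (* On [N] the map [z] is constantly [phi point], so [N] contributes all of itself or nothing. *)
  have fE : f @^-1` (phi @^-1` U) = (\bigcup_(k in L) A k `\` N) `|`
      (N `&` (if `[< U (phi point) >] then setT else set0)).
    apply/seteqP; split=> x; rewrite /f /= psiK; have [zN _] := zP x.
    - have [Nx|Nx] := pselect (N x).
        by rewrite zN// => Ux; right; rewrite asboolT.
      by move=> /(zU _ Nx)[k Lk Akx]; left; split => //; exists k.
    - move=> [[[k Lk Akx] Nx]|[Nx]]; last first.
        by case: asboolP => // Ux _; rewrite zN.
      by apply/(zU _ Nx); exists k.
  have mfU : measurable (f @^-1` (phi @^-1` U)).
    rewrite fE; apply: measurableU; first exact: measurableD.
    by apply: measurableI => //; case: ifP.
  split => //.
  have -> : nu (phi @^-1` U) = mu (\bigcup_(k in L) A k).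
    rewrite unionAB -[in LHS](bigcup_dyadic_inside R P q q_dense U oU).
    by rewrite preimage_bigcup.
  (* The two sets coincide once the null set [N] is added to each. *)
  rewrite -(measureU0 mfU mN N0) -(measureU0 (mUA L) mN N0); congr (mu _).
  rewrite fE; apply/seteqP; split=> x.
    by case=> [[[]|[]]|]; [left|right|right].
  by have [Nx|Nx] := pselect (N x); [right|case=> // Ax; left; left].
have mf : measurable_fun setT f.
  apply: (measurability G genG) => _ [_ [U oU <-] <-].
  by rewrite setTI; have [] := preU _ oU.
exists f => // C; rewrite genG => GC.
(* Preimages of open sets are stable under intersection and generate, so agreement on them extends
   to all measurable sets. *)
apply: (@g_sigma_algebra_measure_unique _ R Y G mG (fun=> setT) _ _
  (measure_function_pushforward__canonical__measure_function_Measure mu mf) nu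
  _ _ _ C GC).
- by move=> _; exists setT; [exact: openT|exact: preimage_setT].
- by rewrite bigcup_const//; exists 0%N.
- move=> _ _ [U oU <-] [V oV <-]; rewrite -preimage_setI.
  by exists (U `&` V) => //; exact: openI.
- by move=> _ [U oU <-]; have [] := preU _ oU.
- move=> _; rewrite /= /pushforward preimage_setT.
  by rewrite [X in (X < _)%E](probability_setT mu) ltry.
Qed.

(** * Equivalent probabilities and comparison of null sets *)

Lemma equivalent_probability (R : realType) (d : measure_display)
    (X : measurableType d) (mu : {sigma_finite_measure set X -> \bar R})
    (W : set X) : measurable W -> mu W <> 0%E ->
  exists P : probability X R,
    forall A, measurable A -> P A = 0%E <-> mu (A `&` W) = 0%E.
Proof.
move=> mW W0; have [F TF /all_and2[mF Foo]] := sigma_finiteT mu.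
have mFW n : measurable (F n `&` W) by exact: measurableI.
(* These positive weights give the [n]-th piece mass at most [1 / 2 ^ n.+1], so the sum is finite
   with the same null sets as [mu] on [W]. *)
pose c n : R := 1 / (2 ^ n.+1)%:R / (1 + fine (mu (F n))).
have F1 n : 0 < 1 + fine (mu (F n)) by rewrite ltr_pwDl// fine_ge0.
have c_gt0 n : 0 < c n by rewrite /c !divr_gt0// ltr0n expn_gt0.
pose m n : {measure set X -> \bar R} :=
  mscale (NngNum (ltW (c_gt0 n))) (mrestr mu (mFW n)).
have mE n A : m n A = ((c n)%:E * mu (A `&` (F n `&` W)))%E by [].
pose M : {measure set X -> \bar R} := mseries m 0.
have ME A : M A = (\sum_(0 <= n <oo) m n A)%E by [].
have Mlty : (M setT < +oo)%E.
  rewrite (@le_lt_trans _ _ 1%:E) ?ltry// ME.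
  apply: le_trans (epsilon_trick0 xpredT (@ler01 R)).
  apply: lee_nneseries => // n _.
  have mFn : (mu (F n `&` W) <= mu (F n))%E.
    by apply: le_measure; rewrite ?inE; [exact: mFW|exact: mF|exact: subIsetl].
  have FWfin : mu (F n `&` W) \is a fin_num.
    by rewrite ge0_fin_numE//; exact: le_lt_trans mFn (Foo n).
  have Ffin : mu (F n) \is a fin_num by rewrite ge0_fin_numE//; exact: Foo.
  rewrite mE setTI -(fineK FWfin) -EFinM lee_fin /c mulrAC.
  rewrite ler_pdivrMr// ler_pM2l ?divr_gt0 ?ltr0n ?expn_gt0//.
  by rewrite (@le_trans _ _ (fine (mu (F n)))) ?lerDr// fine_le.
have MW A : measurable A -> M A = 0%E <-> mu (A `&` W) = 0%E.
  move=> mA; split=> [MA0|AW0]; last first.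
    rewrite ME eseries0// => n _ _; rewrite mE.
    rewrite (_ : mu _ = 0%E) ?mule0//.
    apply: (subset_measure0 _ _ _ AW0) => //; try exact: measurableI.
    by move=> x [Ax [_ Wx]].
  have mA0 n : mu (A `&` (F n `&` W)) = 0%E.
    have : (m n A <= 0)%E.
      rewrite -MA0 ME; apply: le_trans (nneseries_lim_ge n.+1 _) => //.
      by rewrite big_nat_recr//= leeDr// sume_ge0.
    by rewrite mE pmule_rle0 ?lte_fin// measure_le0 => /eqP.
  apply/negligibleP; first exact: measurableI.
  have -> : A `&` W = \bigcup_n (A `&` (F n `&` W)).
    apply/seteqP; split=> [x [Ax Wx]|x [n _ [Ax [_ Wx]]]]; last by [].
    have : setT x by [].
    by rewrite TF => -[n _ Fnx]; exists n.
  apply: negligible_bigcup => n; apply/negligibleP; [|exact: mA0].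
  exact: measurableI.
have M0 : M setT <> 0%E by move=> /(MW _ measurableT); rewrite setTI.
exists (mnormalize M (dirac point)) => A mA.
rewrite -MW// /= /mnormalize /=.
have -> : (M setT == 0%E) || (M setT == +oo%E) = false.
  apply/negbTE; rewrite negb_or.
  by apply/andP; split; [exact/eqP|rewrite lt_eqF].
split=> [/eqP|->]; last by rewrite mul0e.
rewrite mule_eq0 eqe invr_eq0 fine_eq0 ?ge0_fin_numE//.
by move=> /orP[/eqP//|/eqP/M0].
Qed.

(** Domination speaks of sets all of whose measurable subsets are null; for a measurable set,
    monotonicity reduces this to measure zero. *)
Lemma measure_equiv_pushforwardP (R : realType) (d d' : measure_display)
    (X : measurableType d) (Y : measurableType d')
    (mu : {measure set X -> \bar R}) (nu : {measure set Y -> \bar R})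
    (f : X -> Y) : measurable_fun setT f ->
  measure_equiv (pushforward mu f) nu <->
  forall A, measurable A -> mu (f @^-1` A) = 0%E <-> nu A = 0%E.
Proof.
move=> mf.
have mpre A : measurable A -> measurable (f @^-1` A).
  by move=> mA; rewrite -[_ @^-1` _]setTI; exact: mf.
split=> [[fnu nuf] A mA|H]; split.
- move=> fA0; apply: (nuf A) => // B mB BA.
  by apply: (subset_measure0 _ _ (preimage_subset BA)) => //; exact: mpre.
- move=> nuA0; apply: (fnu A) => //; exact/measure0_null_setP.
- by apply/null_content_dominatesP => A mA /H; exact.
- by move=> A nA B mB BA; apply/(H _ mB); exact: nA.
Qed.

(** * Integer powers of an invertible nonsingular map *)

Section integer_iterates.
Context (X : Type) (T Ti : X -> X).
Hypotheses (TK : cancel T Ti) (TiK : cancel Ti T).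

(** For mutually inverse [U] and [V] this is the power [U^n]; exchanging the two arguments gives
    [U^(-n)] without a change of sign in [n]. *)
Definition int_iter (U V : X -> X) (n : int) : X -> X :=
  match n with Posz k => iter k U | Negz k => iter k.+1 V end.

Let NegzS k : Negz k.+1 + 1 = Negz k.
Proof. by rewrite !NegzE (intS k.+1) opprD addrAC addNr add0r. Qed.

Lemma int_iterS n x : int_iter T Ti (n + 1) x = T (int_iter T Ti n x).
Proof.
case: n => [k|[|k]]; first by rewrite -PoszD addn1.
  by rewrite /= TiK.
by rewrite NegzS /= TiK.
Qed.

Lemma int_iterVS n x : int_iter Ti T (n + 1) (T x) = int_iter Ti T n x.
Proof.
case: n => [k|[|k]]; first by rewrite -PoszD addn1 [LHS]iterSr TK.
  by [].
by rewrite NegzS /int_iter -iterSr.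
Qed.

Lemma iter_cancel (U V : X -> X) k : cancel U V -> cancel (iter k U) (iter k V).
Proof. by move=> UK; elim: k => // k IH x; rewrite iterSr iterS UK IH. Qed.

Lemma translateE n W : translate T n W = int_iter Ti T n @^-1` W.
Proof.
case: n => // k; apply/seteqP; split=> [_ [x Wx <-]|x Wx] /=.
  by rewrite iter_cancel.
by exists (iter k Ti x) => //; rewrite iter_cancel.
Qed.

End integer_iterates.

Lemma int_iter_null_preimage (R : realType) (d : measure_display)
    (X : measurableType d) (mu : {measure set X -> \bar R}) (U V : X -> X)
    (n : int) :
  measurable_fun setT U -> measurable_fun setT V ->
  (forall A, measurable A -> mu (U @^-1` A) = 0%E <-> mu A = 0%E) ->
  (forall A, measurable A -> mu (V @^-1` A) = 0%E <-> mu A = 0%E) ->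
  measurable_fun setT (int_iter X U V n) /\
  forall A, measurable A -> mu (int_iter X U V n @^-1` A) = 0%E <-> mu A = 0%E.
Proof.
have iterP (F : X -> X) k : measurable_fun setT F ->
    (forall A, measurable A -> mu (F @^-1` A) = 0%E <-> mu A = 0%E) ->
    measurable_fun setT (iter k F) /\
    forall A, measurable A -> mu (iter k F @^-1` A) = 0%E <-> mu A = 0%E.
  move=> mF F0; elim: k => [|k [mk k0]].
    by split; first exact: measurable_id.
  split=> [|A mA]; first exact: (measurableT_comp mF mk).
  rewrite -(F0 A mA) -(k0 (F @^-1` A))//.
  by rewrite -[_ @^-1` _]setTI; exact: mF.
by move=> mU mV U0 V0; case: n => k; exact: iterP.
Qed.

Lemma nonsingularP (R : realType) (d : measure_display) (X : measurableType d)
    (mu : {sigma_finite_measure set X -> \bar R}) (T : X -> X) :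
  nonsingular_system mu T ->
  exists Ti, [/\ cancel T Ti, cancel Ti T & forall n U V,
    (U, V) = (T, Ti) \/ (U, V) = (Ti, T) ->
    measurable_fun setT (int_iter X U V n) /\
    forall A, measurable A ->
      mu (int_iter X U V n @^-1` A) = 0%E <-> mu A = 0%E].
Proof.
move=> [_ _ [[Ti TK TiK] mT imT] equiv].
have mTi : measurable_fun setT Ti.
  move=> _ A mA; rewrite setTI (_ : _ @^-1` _ = T @` A); first exact: imT.
  apply/seteqP; split=> [x Ax|_ [x Ax <-]]; last by rewrite /= TK.
  by exists (Ti x).
have T0 := (measure_equiv_pushforwardP _ _ _ _ _ mu mu T mT).1 equiv.
have Ti0 A : measurable A -> mu (Ti @^-1` A) = 0%E <-> mu A = 0%E.
  (* Apply the equivalence for [T] to the preimage of [A] under [Ti], which [T] pulls back to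
     [A]. *)
  move=> mA; rewrite -T0; last by rewrite -[_ @^-1` _]setTI; exact: mTi.
  by rewrite -comp_preimage (_ : Ti \o T = id)//; exact/funext.
exists Ti; split => // n U V [] [-> ->]; exact: int_iter_null_preimage.
Qed.

(** * The equivariant map on the translates of the wandering set *)

Theorem theorem1p1 (R : realType) (d : measure_display) (X : measurableType d)
    (mu : {sigma_finite_measure set X -> \bar R}) (T : X -> X) :
  nonsingular_system mu T -> non_atomic mu -> totally_dissipative mu T ->
  factor_universal mu T.
Proof.
move=> nsT mu_na [W [mW tW] Wfull] d' Y nu S nsS.
have [Ti [TK TiK Titer]] := nonsingularP _ _ _ _ _ nsT.
have [Si [SK SiK Siter]] := nonsingularP _ _ _ _ _ nsS.
have [mTn Tn0] := all_and2 (fun n => Titer n Ti T (or_intror erefl)).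
have [mSn Sn0] := all_and2 (fun n => Siter n S Si (or_introl erefl)).
have EE n := translateE _ _ _ TK TiK n W.
have mE n : measurable (translate T n W).
  by rewrite EE -[_ @^-1` _]setTI; exact: mTn.
have [_ muT _ _] := nsT; have [Ysb nuT _ _] := nsS.
(* If [W] were null, so would be all its translates, and with them the whole space. *)
have W0 : mu W <> 0%E.
  move=> W0; apply: muT; apply/negligibleP => //.
  rewrite -(setUv (\bigcup_(n in [set: int]) translate T n W)).
  apply: negligibleU => //; apply: negligible_bigcup_countable => n _.
  by apply/negligibleP => //; rewrite EE; apply/Tn0.
have [P PW] := equivalent_probability _ _ _ mu W mW W0.
have [Q Qnu] := equivalent_probability _ _ _ nu setT measurableT nuT.
(* An atom [A] of [P] would make [A] intersected with [W] an atom of [mu]. *)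
have P_na : non_atomic P.
  move=> A [mA PA0 PA]; apply: (mu_na (A `&` W)); split.
  - exact: measurableI.
  - by move/(PW _ mA).
  - move=> B mB BAW; have BA : B `<=` A by move=> x /BAW[].
    have BW : B `&` W = B by apply/setIidPl => x /BAW[].
    have [B0|AB0] := PA B mB BA; [left|right].
      by move/(PW _ mB): B0; rewrite BW.
    have mAB : measurable (A `\` B) by exact: measurableD.
    by move/(PW _ mAB): AB0; rewrite !setDE setIAC.
have [f mf fPQ] := standard_borel_map _ _ _ _ _ P Q P_na Ysb.
have f0 C : measurable C -> mu (f @^-1` C `&` W) = 0%E <-> nu C = 0%E.
  move=> mC; rewrite -PW; last by rewrite -[_ @^-1` _]setTI; exact: mf.
  by rewrite fPQ// Qnu// setIT.
pose V := \bigcup_(n in [set: int]) translate T n W.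
have mV : measurable V by exact: countable_bigcupT_measurable.
pose g n := int_iter Y S Si n \o f \o int_iter X Ti T n.
have mg n : measurable_fun setT (g n).
  by apply: measurableT_comp => //; exact: measurableT_comp.
have [idx idxP] : {idx : X -> int & forall x, V x -> translate T (idx x) W x}.
  apply: (@choice _ _ (fun x n => V x -> translate T n W x)) => x.
  by have [[n _ Wx]|] := pselect (V x); [exists n|exists 0].
(* Disjointness of the translates makes [idx x] the only possible index on [V]; the constant [point]
   is used on the null complement. *)
pose p x := if x \in V then g (idx x) x else point.
have pE n x : translate T n W x -> p x = g n x.
  move=> Wx; have Vx : V x by exists n.
  rewrite /p mem_set//; congr (g _ x); apply: (tW _ _ I I).
  by exists x; split => //; exact: idxP.
have pV x : ~ V x -> p x = point by move=> Vx; rewrite /p memNset.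
have preE (B : set Y) : p @^-1` B =
    (\bigcup_(n in [set: int]) (translate T n W `&` g n @^-1` B)) `|`
    (~` V `&` p @^-1` B).
  apply/seteqP; split=> x /=.
    have [Vx|Vx] := pselect (V x); last by right.
    have [n _ Wx] := Vx; rewrite (pE n)// => Bx; left; exists n => //.
  by case=> [[n _ [Wx]]|[]//]; rewrite /= (pE n).
have mp : measurable_fun setT p.
  move=> _ B mB; rewrite setTI preE; apply: measurableU.
    apply: countable_bigcupT_measurable => // n; apply: measurableI => //.
    by rewrite -[_ @^-1` _]setTI; exact: mg.
  rewrite (_ : _ `&` _ = ~` V `&` (if `[< B point >] then setT else set0)).
    by apply: measurableI; [exact: measurableC|case: ifP].
  apply/seteqP; split=> x [Vx]; rewrite /= pV//.
    by split => //; rewrite asboolT.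
  by case: asboolP.
(* Each piece is a pullback under [T^(-n)] of a set in [W], so it is null exactly when [B] is, by
   nonsingularity of [T], the choice of [f] and nonsingularity of [S]. *)
have pieceE n B : translate T n W `&` g n @^-1` B =
    int_iter X Ti T n @^-1` (f @^-1` (int_iter Y S Si n @^-1` B) `&` W).
  by rewrite EE setIC.
have mSB n B : measurable B -> measurable (int_iter Y S Si n @^-1` B).
  by move=> mB; rewrite -[_ @^-1` _]setTI; exact: mSn.
have mfW C : measurable C -> measurable (f @^-1` C `&` W).
  by move=> mC; apply: measurableI => //; rewrite -[_ @^-1` _]setTI; exact: mf.
have mpiece n B : measurable B -> measurable (translate T n W `&` g n @^-1` B).
  move=> mB; rewrite pieceE -[_ @^-1` _]setTI; apply: mTn => //.
  by apply: mfW; exact: mSB.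
have piece0 n B : measurable B ->
    mu (translate T n W `&` g n @^-1` B) = 0%E <-> nu B = 0%E.
  move=> mB; rewrite pieceE Tn0; last by apply: mfW; exact: mSB.
  by rewrite f0 ?Sn0//; exact: mSB.
exists p; split => //.
  (* Equivariance can fail only off [V]: if [x] is in [T^n W], then [T x] is in [T^(n+1) W], and
     [T^(-n-1) T x = T^(-n) x]. *)
  apply: negligibleS Wfull => x /= pTx [n _ Wx]; apply: pTx.
  have WTx : translate T (n + 1) W (T x).
    by move: Wx; rewrite !EE /= int_iterVS.
  by rewrite (pE _ _ Wx) (pE _ _ WTx) /g /= int_iterVS// int_iterS.
apply/measure_equiv_pushforwardP => // B mB; split=> [pB0|B0].
  (* The piece inside [W] alone already detects whether [B] is null; the converse needs all
     pieces. *)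
  apply/(piece0 0 B mB).
  apply: (subset_measure0 _ _ _ pB0).
  - exact: mpiece.
  - by rewrite -[_ @^-1` _]setTI; exact: mp.
  - by rewrite [X in _ `<=` X]preE => x ?; left; exists 0.
apply/negligibleP; first by rewrite -[_ @^-1` _]setTI; exact: mp.
rewrite preE; apply: negligibleU.
  apply: negligible_bigcup_countable => n _; apply/negligibleP.
    exact: mpiece.
  exact/piece0.
exact: negligibleS Wfull.
Qed.
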